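(* Let the finite graph $(V,E)$ have connected components $V_1,\dots,V_c$, and let $k\ge1$. Call a component anchored if $a_i>0$ for at least one node $i$ in that component. Then: (1) $B$ is globally injective if and only if every component is anchored; (2) $\gamma_k(D,A)=0$ if and only if some unanchored component has at most $2k$ nodes. Both statements hold for every fiber dimension $d\ge1$.
   Context: $(V,E)$ is a finite graph with $V=\{1,\dots,n\}$, $n\ge1$, and edge weights $w_e>0$. Every node fiber is $\mathbb R^d$ and $\mathcal H=(\mathbb R^d)^n$ with the Euclidean norm. For an arbitrary orientation of the edges, $D$ is the weighted incidence operator (identity transports) $(Dx)_e=\sqrt{w_e}(x_j-x_i)$ for $e=(i,j)$. The anchor operator acts isotropically with strengths $a_i\ge0$: $(Ax)_i=a_ix_i$. The stacked operator is $Bx=(Dx,\,Ax)$, so $\|Bx\|_2^2=\sum_{(i,j)\in E}w_{ij}\|x_i-x_j\|_2^2+\sum_ia_i^2\|x_i\|_2^2$. Group sparsity is $\|x\|_{0,\mathrm g}=|\{i:x_i\ne0\}|$ and $\gamma_k(D,A)=\min\{\|Bx\|_2/\|x\|_2:x\neq0,\ \|x\|_{0,\mathrm g}\le2k\}$. *)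

(* Defs.v *)
From mathcomp Require Import all_boot all_order all_algebra.
From mathcomp Require Import all_classical all_reals all_analysis.
Set Implicit Arguments.
Unset Strict Implicit.
Unset Printing Implicit Defensive.
Import Order.TTheory GRing.Theory Num.Theory.
Import numFieldNormedType.Exports.
Local Open Scope classical_set_scope.
Local Open Scope ring_scope.

(* A finite simple graph on the nodes 'I_n is its set E of edges, each edge
   being a two-element set of nodes. *)
Notation edge E := {e : {set 'I__} | e \in E}.

Definition simple_graph n (E : {set {set 'I_n}}) : Prop :=
  forall e, e \in E -> #|e| = 2%N.

Definition orientation n (E : {set {set 'I_n}}) (tail head : edge E -> 'I_n) :
    Prop :=
  forall e, val e = [set tail e; head e]%SET.

Definition adjacent n (E : {set {set 'I_n}}) : rel 'I_n :=
  fun i j => [set i; j]%SET \in E.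

Definition components n (E : {set {set 'I_n}}) : {set {set 'I_n}} :=
  equivalence_partition (connect (adjacent E)) [set: 'I_n]%SET.

Definition anchored (R : realType) n (a : 'I_n -> R) (C : {set 'I_n}) : bool :=
  [exists i in C, 0 < a i].

(* I-indexed families of vectors of R^d. *)
Notation fibered R d I := {ffun I -> 'rV[R]_d}.

(* The norm `|_| provided by the library on 'rV[R]_d is the sup norm, hence the
   explicit Euclidean norm. *)
Definition norm2 (R : realType) d (I : finType) (x : fibered R d I) : R :=
  Num.sqrt (\sum_i \sum_(l < d) (x i 0 l) ^+ 2).

Definition group_sparsity (R : realType) d (I : finType) (x : fibered R d I) :
    nat :=
  #|[set i | x i != 0]%SET|.

Definition incidence_op (R : realType) n d (E : {set {set 'I_n}})
    (w : edge E -> R) (tail head : edge E -> 'I_n) (x : fibered R d 'I_n) :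
    fibered R d (edge E) :=
  [ffun e => Num.sqrt (w e) *: (x (head e) - x (tail e))].

Definition anchor_op (R : realType) n d (a : 'I_n -> R)
    (x : fibered R d 'I_n) : fibered R d 'I_n :=
  [ffun i => a i *: x i].

(* The direct sum of two spaces of families is the space of families indexed
   by the disjoint union, so that norm2 is its Euclidean norm. *)
Definition stacked_op (R : realType) d (I J K : finType)
    (D : fibered R d I -> fibered R d J) (A : fibered R d I -> fibered R d K)
    (x : fibered R d I) : fibered R d (J + K)%type :=
  [ffun s => match s with inl e => D x e | inr i => A x i end].

Definition gamma_ratios (R : realType) d (I J K : finType) (k : nat)
    (D : fibered R d I -> fibered R d J) (A : fibered R d I -> fibered R d K) :
    set R :=
  [set norm2 (stacked_op D A x) / norm2 x
    | x in [set x | x != 0 /\ (group_sparsity x <= 2 * k)%N]].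

(* gamma_k is a minimum; it is written with the total operator inf, and
   gamma_is_min below proves that the infimum is attained. *)
Definition gamma (R : realType) d (I J K : finType) (k : nat)
    (D : fibered R d I -> fibered R d J) (A : fibered R d I -> fibered R d K) :
    R :=
  inf (gamma_ratios k D A).

Lemma norm2_stacked_sqr (R : realType) n d (E : {set {set 'I_n}})
    (w : edge E -> R) (tail head : edge E -> 'I_n) (a : 'I_n -> R)
    (x : fibered R d 'I_n) :
  (forall e, 0 < w e) ->
  norm2 (stacked_op (incidence_op w tail head) (anchor_op a) x) ^+ 2 =
  \sum_e w e * (\sum_(l < d) ((x (head e) - x (tail e)) 0 l) ^+ 2) +
  \sum_i a i ^+ 2 * (\sum_(l < d) (x i 0 l) ^+ 2).
Proof.
move=> w0; rewrite sqr_sqrtr; last first.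
  by apply: sumr_ge0 => i _; apply: sumr_ge0 => l _; exact: sqr_ge0.
rewrite big_sumType /=; congr (_ + _); apply: eq_bigr => i _;
  rewrite mulr_sumr; apply: eq_bigr => l _; rewrite !ffunE !mxE exprMn //.
by rewrite sqr_sqrtr // ltW.
Qed.

Section attained.
Variables (R : realType) (d : nat).

Let unvec n (v : 'rV[R]_(n * d)) : fibered R d 'I_n :=
  [ffun i => \row_l v 0 (mxvec_index i l)].

Let continuous_bigsum (T : topologicalType) (I : finType) (f : I -> T -> R) :
  (forall i, continuous (f i)) -> continuous (fun v => \sum_i f i v).
Proof. by move=> cf; apply: continuous_big => //; exact: add_continuous. Qed.

Let continuous_unvec n (i : 'I_n) (l : 'I_d) :
  continuous (fun v : 'rV[R]_(n * d) => unvec v i 0 l).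
Proof.
rewrite (_ : (fun _ => _) = (fun v : 'rV[R]_(n * d) => v 0 (mxvec_index i l))).
  exact: coord_continuous.
by apply/funext => v; rewrite !ffunE mxE.
Qed.

Let continuous_sqr (T : topologicalType) (f : T -> R) :
  continuous f -> continuous (fun v => f v ^+ 2).
Proof. by move=> cf v; rewrite /continuous_at expr2; apply: cvgM; exact: cf. Qed.

Let continuous_scale (T : topologicalType) (c : R) (f : T -> R) :
  continuous f -> continuous (fun v => c * f v).
Proof. by move=> cf v; apply: cvgMl_tmp; exact: cf. Qed.

Let continuous_diff (T : topologicalType) (f g : T -> R) :
  continuous f -> continuous g -> continuous (fun v => f v - g v).
Proof. by move=> cf cg v; apply: cvgB; [exact: cf|exact: cg]. Qed.

Let continuous_norm2 n (J : finType)
    (F : fibered R d 'I_n -> fibered R d J) :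
  (forall j l, continuous (fun v : 'rV[R]_(n * d) => F (unvec v) j 0 l)) ->
  continuous (fun v : 'rV[R]_(n * d) => norm2 (F (unvec v))).
Proof.
move=> cF v; apply: continuous_comp; last exact: sqrt_continuous.
apply: (@continuous_bigsum _ J) => j; apply: (@continuous_bigsum _ 'I_d) => l.
exact: continuous_sqr.
Qed.

Let norm2Z (I : finType) (c : R) (x : fibered R d I) :
  norm2 (c *: x) = `|c| * norm2 x.
Proof.
rewrite /norm2 -sqrtr_sqr -sqrtrM ?sqr_ge0 // mulr_sumr; congr Num.sqrt.
apply: eq_bigr => i _; rewrite mulr_sumr; apply: eq_bigr => l _.
by rewrite ffunE mxE exprMn.
Qed.

Let norm2_gt0 (I : finType) (x : fibered R d I) : (0 < norm2 x) = (x != 0).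
Proof.
have s0 i : 0 <= \sum_(l < d) (x i 0 l) ^+ 2.
  by apply: sumr_ge0 => l _; exact: sqr_ge0.
rewrite sqrtr_gt0 lt0r sumr_ge0 ?andbT //; congr (~~ _).
rewrite psumr_eq0 //; apply/idP/eqP => [/allP h|->].
  apply/ffunP => i; apply/rowP => l; rewrite !ffunE mxE.
  have := h i (mem_index_enum i); rewrite psumr_eq0; last first.
    by move=> ? _; exact: sqr_ge0.
  by move=> /allP/(_ l (mem_index_enum l)) /=; rewrite sqrf_eq0 => /eqP.
apply/allP => i _ /=; rewrite big1 // => l _.
by rewrite ffunE mxE expr0n.
Qed.

Lemma gamma_is_min n (E : {set {set 'I_n}}) (w : edge E -> R)
    (tail head : edge E -> 'I_n) (a : 'I_n -> R) (k : nat)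
    (D := @incidence_op R n d E w tail head) (A := @anchor_op R n d a) :
  (0 < n)%N -> (0 < d)%N -> (0 < k)%N ->
  gamma_ratios k D A (gamma k D A) /\
  lbound (gamma_ratios k D A) (gamma k D A).
Proof.
move=> n0 d0 k0; set S := gamma_ratios k D A.
suff [m Sm mS] : exists2 m, S m & lbound S m.
  suff -> : gamma k D A = m by [].
  apply/eqP; rewrite eq_le; apply/andP; split.
    by apply: ge_inf => //; exists m.
  by apply: lb_le_inf => //; exists m.
pose B := stacked_op D A.
have BZ c x : B (c *: x) = c *: B x.
  apply/ffunP => -[e|i]; rewrite !ffunE.
    by rewrite -scalerBr !scalerA mulrC.
  by rewrite !scalerA mulrC.
have cn : continuous (fun v : 'rV[R]_(n * d) => norm2 (unvec v)).
  apply: (@continuous_norm2 n 'I_n id) => j l; exact: continuous_unvec.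
have cB : continuous (fun v : 'rV[R]_(n * d) => norm2 (B (unvec v))).
  apply: continuous_norm2 => -[e|i] l.
    rewrite (_ : (fun _ => _) = (fun v => Num.sqrt (w e) *
        (unvec v (head e) 0 l - unvec v (tail e) 0 l))).
      by apply: continuous_scale; apply: continuous_diff; exact: continuous_unvec.
    by apply/funext => v; rewrite !ffunE !mxE.
  rewrite (_ : (fun _ => _) = (fun v => a i * unvec v i 0 l)).
    by apply: continuous_scale; exact: continuous_unvec.
  by apply/funext => v; rewrite !ffunE !mxE.
pose Z i : set 'rV[R]_(n * d) := [set v | unvec v i = 0].
pose KS : set 'rV[R]_(n * d) :=
  \bigcup_(T in [set T : {set 'I_n} | (#|T| <= 2 * k)%N])
    \bigcap_(i in [set i | i \notin T]) Z i.
have KSE v : KS v <-> (group_sparsity (unvec v) <= 2 * k)%N.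
  split=> [[T /= Tk TZ]|h].
    apply: leq_trans Tk; apply: subset_leq_card; apply/fintype.subsetP => i.
    rewrite inE; apply: contraNT => iT; apply/eqP; exact: TZ.
  exists [set i | unvec v i != 0]%SET => //= i /=.
  by rewrite inE negbK => /eqP.
have cZ i : closed (Z i).
  rewrite (_ : Z i = \bigcap_(l in [set: 'I_d])
      ((fun v => unvec v i 0 l) @^-1` [set (0 : R)])).
    apply: closed_bigI => l _.
    apply: (proj1 (continuous_closedP _) (@continuous_unvec n i l)).
    exact: closed_eq.
  apply/seteqP; split=> v /= h.
    by move=> l _ /=; rewrite h mxE.
  by apply/rowP => l; rewrite [RHS]mxE; exact: (h l).
have cKS : closed KS.
  apply: closed_bigcup => [|T _]; first exact: finite_finset.
  by apply: closed_bigI => i _.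
pose K := KS `&` [set v | norm2 (unvec v) = 1].
have vecK (x : fibered R d 'I_n) : exists v, unvec v = x.
  exists (mxvec (\matrix_(i, l) x i 0 l)).
  by apply/ffunP => i; apply/rowP => l; rewrite ffunE mxE mxvecE mxE.
have normal x : x != 0 -> (group_sparsity x <= 2 * k)%N ->
    exists2 v, K v & norm2 (B (unvec v)) = norm2 (B x) / norm2 x.
  move=> x0 xk; have xp : 0 < norm2 x by rewrite norm2_gt0.
  have [v vE] := vecK ((norm2 x)^-1 *: x).
  have ai : `|(norm2 x)^-1| = (norm2 x)^-1.
    by rewrite ger0_norm // invr_ge0 ltW.
  exists v; rewrite ?vE; last by rewrite BZ norm2Z ai mulrC.
  split; last by rewrite /= vE norm2Z ai mulVf // gt_eqF.
  apply/KSE; rewrite vE; apply: leq_trans xk; apply: subset_leq_card.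
  apply/fintype.subsetP => i; rewrite !inE ffunE; apply: contraNN => /eqP ->.
  by rewrite scaler0.
have K0 : K !=set0.
  pose x : fibered R d 'I_n := [ffun i => if i == Ordinal n0 then const_mx 1 else 0].
  have [||v Kv _] := normal x; last by exists v.
    apply/eqP => /ffunP/(_ (Ordinal n0))/rowP/(_ (Ordinal d0)).
    by rewrite !ffunE eqxx !mxE => /eqP; rewrite oner_eq0.
  apply: (@leq_trans 1%N); last by rewrite muln_gt0.
  rewrite -(cards1 (Ordinal n0)); apply: subset_leq_card.
  apply/fintype.subsetP => i; rewrite !inE ffunE.
  by case: (i == Ordinal n0); rewrite ?eqxx.
have cK : compact K.
  apply: bounded_closed_compact.
    exists 1; split; first exact: num_real.
    move=> M M1 v [_ /= v1]; apply: le_trans (ltW M1).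
    rewrite [`|v|]mx_normrE; apply: bigmax_le => // -[z m] _ /=.
    rewrite (ord1 z); case/mxvec_indexP: m => i l.
    have -> : v 0 (mxvec_index i l) = unvec v i 0 l by rewrite ffunE mxE.
    rewrite -v1 -sqrtr_sqr; apply: ler_wsqrtr.
    rewrite (bigD1 i) //= (bigD1 l) //= -addrA lerDl addr_ge0 //.
      by apply: sumr_ge0 => ? _; exact: sqr_ge0.
    by apply: sumr_ge0 => ? _; apply: sumr_ge0 => ? _; exact: sqr_ge0.
  apply: closedI => //.
  rewrite (_ : [set v | _] =
    (fun v : 'rV[R]_(n * d) => norm2 (unvec v)) @^-1` [set (1 : R)]) //.
  by apply: (proj1 (continuous_closedP _) cn); exact: closed_eq.
have [c cK' cmin] : exists2 c, c \in K & forall t, t \in K ->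
    norm2 (B (unvec c)) <= norm2 (B (unvec t)).
  by apply: EVT_min_rV => //; apply: continuous_subspaceT.
exists (norm2 (B (unvec c))).
  have [/KSE cs /= c1] := set_mem cK'.
  exists (unvec c); last by rewrite c1 divr1.
  by split => //; rewrite -norm2_gt0 c1.
move=> _ [x [x0 xk] <-]; have [v Kv <-] := normal x x0 xk.
exact/cmin/mem_set.
Qed.

End attained.

(* Main.v *)
(** The kernel of B consists of the families that are constant on every
    connected component and vanish on the anchored ones. A nonzero kernel vector
    is therefore supported on a union of unanchored components, and conversely
    the indicator of an unanchored component lies in the kernel. Since the
    minimum defining gamma_k is attained, gamma_k = 0 means that some nonzero
    kernel vector has at most 2k nonzero blocks. *)
Require Import Defs.
From mathcomp Require Import all_boot all_order all_algebra.
From mathcomp Require Import all_classical all_reals all_analysis.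
Import Order.TTheory GRing.Theory Num.Theory.
Local Open Scope ring_scope.

Lemma norm2_eq0 (R : realType) (d : nat) (I : finType) (x : fibered R d I) :
  (norm2 x == 0) = (x == 0).
Proof.
have s0 i : 0 <= \sum_(l < d) (x i 0 l) ^+ 2.
  by apply: sumr_ge0 => l _; exact: sqr_ge0.
rewrite sqrtr_eq0 le_eqVlt ltNge sumr_ge0 ?orbF //.
rewrite psumr_eq0 //; apply/idP/eqP => [/allP h|->].
  apply/ffunP => i; apply/rowP => l; rewrite !ffunE mxE.
  have := h i (mem_index_enum i); rewrite psumr_eq0; last first.
    by move=> ? _; exact: sqr_ge0.
  by move=> /allP/(_ l (mem_index_enum l)) /=; rewrite sqrf_eq0 => /eqP.
by apply/allP => i _ /=; rewrite big1 // => l _; rewrite ffunE mxE expr0n.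
Qed.

Lemma connect_adjacent_sym (n : nat) (E : {set {set 'I_n}}) :
  connect_sym (Defs.adjacent E).
Proof. by apply: sym_connect_sym => i j; rewrite /Defs.adjacent finset.setUC. Qed.

Lemma componentsP (n : nat) (E : {set {set 'I_n}}) (C : {set 'I_n}) :
  reflect (exists i, C = [set j | connect (Defs.adjacent E) i j]%SET)
          (C \in components E).
Proof.
apply: (iffP imsetP) => [[i _ ->]|[i ->]]; exists i => //;
  by apply/setP => j; rewrite !inE.
Qed.

Section kernel.
Variables (R : realType) (n d : nat) (E : {set {set 'I_n}}).
Variables (w : edge E -> R) (tail head : edge E -> 'I_n) (a : 'I_n -> R).
Hypotheses (w_gt0 : forall e, 0 < w e) (or_th : orientation tail head).
Hypothesis a_ge0 : forall i, 0 <= a i.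

Let B : fibered R d 'I_n -> fibered R d (edge E + 'I_n)%type :=
  stacked_op (incidence_op w tail head) (anchor_op a).

Lemma stacked_opB (x y : fibered R d 'I_n) : B (x - y) = B x - B y.
Proof.
apply/ffunP => -[e|i]; rewrite !ffunE -scalerBr //; congr (_ *: _).
by rewrite !opprD addrACA.
Qed.

(** A positive weight has a nonzero square root, so a vanishing edge block forces equal values at
    the two ends, and equality spreads along paths by induction. Conversely, each [a i] is either 0,
    which kills the anchor block, or positive, in which case [x i] is 0. *)
Lemma stacked_op_kerP (x : fibered R d 'I_n) :
  B x = 0 <-> (forall i j, connect (Defs.adjacent E) i j -> x i = x j) /\
              (forall i, 0 < a i -> x i = 0).
Proof.
split=> [Bx0|[xC xa]]; last first.
  apply/ffunP => -[e|i]; rewrite !ffunE.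
    rewrite (xC (head e) (tail e)) ?subrr ?scaler0 //; apply: connect1.
    by rewrite /Defs.adjacent finset.setUC -or_th (valP e).
  have := a_ge0 i; rewrite le_eqVlt => /predU1P[<-|/xa ->].
    by rewrite scale0r.
  by rewrite scaler0.
have Dx e : x (head e) = x (tail e).
  have /ffunP/(_ (inl e)) := Bx0; rewrite !ffunE => /eqP.
  by rewrite scaler_eq0 gt_eqF ?sqrtr_gt0 //= subr_eq0 => /eqP.
split=> [i j /connectP[p ip ->]|i ai]; last first.
  have /ffunP/(_ (inr i)) := Bx0; rewrite !ffunE => /eqP.
  by rewrite scaler_eq0 gt_eqF //= => /eqP.
elim: p i ip => //= l p IHp i /andP[il lp]; rewrite -(IHp l lp).
(* The orientation of this edge is unknown, so both end values are compared with the value at its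
   tail. *)
pose e : edge E := exist _ [set i; l]%SET il.
have xtail m : m \in val e -> x m = x (tail e).
  by rewrite or_th !inE => /orP[] /eqP ->.
by rewrite !xtail // !inE eqxx ?orbT.
Qed.

(** Take the component of a node where [x] is nonzero: constancy puts all of it in the support, and
    an anchor in it would force the value 0. *)
Lemma stacked_op_ker_component (x : fibered R d 'I_n) :
  B x = 0 -> x != 0 ->
  exists C, [/\ C \in components E, ~~ anchored a C &
                (#|C| <= group_sparsity x)%N].
Proof.
move=> /stacked_op_kerP[xC xa] x0.
have [i xi0] : exists i, x i != 0.
  apply/existsP; apply: contraNT x0; rewrite negb_exists => /forallP x0.
  by apply/eqP/ffunP => i; rewrite ffunE; apply/eqP; rewrite -[_ == _]negbK.
exists [set j | connect (Defs.adjacent E) i j]%SET; split.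
- by apply/componentsP; exists i.
- apply/existsP => -[j]; rewrite inE => /andP[ij /xa xj0].
  by move: xi0; rewrite (xC i j ij) xj0 eqxx.
- apply: subset_leq_card; apply/fintype.subsetP => j; rewrite !inE => ij.
  by rewrite -(xC i j ij).
Qed.

(** The value placed on [C] is the all-ones row, nonzero because [0 < d]; hence the support is
    exactly [C]. *)
Lemma unanchored_component_ker (C : {set 'I_n}) :
  (0 < d)%N -> C \in components E -> ~~ anchored a C ->
  exists x, [/\ B x = 0, x != 0 & group_sparsity x = #|C|].
Proof.
move=> d0 /componentsP[r CE] Ca.
have one0 : const_mx 1 != 0 :> 'rV[R]_d.
  by apply/eqP => /rowP/(_ (Ordinal d0)); rewrite !mxE => /eqP; rewrite oner_eq0.
exists [ffun i => if i \in C then const_mx 1 else 0]; split.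
- apply/stacked_op_kerP; split=> [i j ij|i ai]; rewrite !ffunE.
    (* Connected nodes lie in the class of [r] together or not at all. *)
    by rewrite CE !inE (same_connect_r (@connect_adjacent_sym _ E) ij).
  by case: ifPn => // iC; case/existsP: Ca; exists i; rewrite iC.
- apply/eqP => /ffunP/(_ r); rewrite !ffunE CE inE connect0 => /eqP.
  by rewrite (negPf one0).
- apply: eq_card => i; rewrite !inE ffunE.
  by case: ifP => _; rewrite ?eqxx ?one0.
Qed.

End kernel.

Theorem proposition32 (R : realType) (n d k : nat)
    (hn : (1 <= n)%N) (hd : (1 <= d)%N) (hk : (1 <= k)%N)
    (E : {set {set 'I_n}}) (hE : simple_graph E)
    (w : edge E -> R) (hw : forall e, 0 < w e)
    (tail head : edge E -> 'I_n) (hor : orientation tail head)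
    (a : 'I_n -> R) (ha : forall i, 0 <= a i) :
  let D : fibered R d 'I_n -> fibered R d (edge E) :=
    incidence_op w tail head in
  let A : fibered R d 'I_n -> fibered R d 'I_n := anchor_op a in
  (injective (stacked_op D A) <->
     forall C, C \in components E -> anchored a C) /\
  (gamma k D A = 0 <->
     exists C, [/\ C \in components E, ~~ anchored a C & (#|C| <= 2 * k)%N]).
Proof.
move=> D A.
have kerC x := @stacked_op_ker_component R n d E w tail head a hw hor ha x.
have Cker C := @unanchored_component_ker R n d E w tail head a hw hor ha C hd.
have BB x y := @stacked_opB R n d E w tail head a x y.
split; split.
- move=> Binj C CE; apply: contraT => /(Cker C CE)[x [Bx0 /eqP[]]].
  (* [B 0 = 0] follows from compatibility with subtraction, on writing 0 as [x - x]. *)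
  by apply: Binj; rewrite Bx0 -[0 in RHS](subrr x) BB subrr.
- move=> anch x y Bxy; apply/eqP; rewrite -subr_eq0; apply: contraT => xy.
  have [|C [/anch -> //]] := kerC _ _ xy.
  by rewrite BB Bxy subrr.
(* Attainment supplies an [x] whose ratio is [gamma k D A]; as [norm2 x] is nonzero, a zero ratio
   means [B x = 0]. *)
- have [[x [x0 xk] <-] _] := @gamma_is_min R d n E w tail head a k hn hd hk.
  move=> /eqP; rewrite mulf_eq0 invr_eq0 !norm2_eq0 (negPf x0) orbF => /eqP Bx0.
  have [C [CE Ca Cx]] := kerC _ Bx0 x0.
  by exists C; split=> //; exact: leq_trans xk.
- move=> [C [CE Ca Ck]]; have [x [Bx0 x0 xC]] := Cker C CE Ca.
  (* The kernel vector has ratio 0, which bounds [gamma k D A] above; it is nonnegative because it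
     is itself a ratio of norms, attained at [y]. *)
  have [[y _ gammaE] lb] := @gamma_is_min R d n E w tail head a k hn hd hk.
  apply/eqP; rewrite eq_le; apply/andP; split.
    apply: lb; exists x; first by rewrite /= xC.
    by apply/eqP; rewrite mulf_eq0 norm2_eq0 Bx0 eqxx.
  by rewrite -[leRHS]gammaE divr_ge0 // sqrtr_ge0.
Qed.
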